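(* Let $k\geq 1$ be an integer. For every $\lambda\in[2,\infty]$ there exists a real transcendental number $\zeta$ such that $\chi_{k}(\zeta,\zeta^{2},\ldots,\zeta^{k})=\lambda_{k}(\zeta)=\lambda$. In particular, the set $\{\chi_{k}(\zeta,\zeta^{2},\ldots,\zeta^{k}):\zeta\in\mathbb{R}\text{ transcendental}\}$ contains $[2,\infty]$.
   Context: $\Vert t\Vert$ denotes the distance of $t\in\mathbb{R}$ to the nearest integer. For $\zeta\in\mathbb{R}$, $\lambda_{k}(\zeta)$ is the supremum of real $\mu$ such that $\max_{1\leq j\leq k}\Vert x\zeta^{j}\Vert\leq x^{-\mu}$ has arbitrarily large integer solutions $x$. For $\underline{\zeta}=(\zeta_{1},\ldots,\zeta_{k})\in\mathbb{R}^{k}$, $\chi_{k}(\underline{\zeta})$ is the supremum of $\nu>0$ such that the system \[ 0<\min_{1\leq j\leq k}\vert x_{j}\vert\leq\max_{1\leq j\leq k}\vert x_{j}\vert\leq X,\qquad \max_{1\leq j\leq k}\Vert x_{j}\zeta_{j}\Vert\leq X^{-\nu} \] has a solution $(x_{1},\ldots,x_{k})\in\mathbb{Z}^{k}$ for arbitrarily large $X$. *)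

(* Defs.v *)
From HB Require Import structures.
From mathcomp Require Import all_boot all_order all_algebra.
From mathcomp Require Import all_classical all_reals all_analysis.
Set Implicit Arguments.
Unset Strict Implicit.
Unset Printing Implicit Defensive.
Import Order.TTheory GRing.Theory Num.Theory.
Local Open Scope classical_set_scope.
Local Open Scope ring_scope.

Definition dist_int (R : realType) (t : R) : R :=
  inf [set `|t - n%:~R| | n in [set: int]].

Definition transcendental (R : realType) (zeta : R) : Prop :=
  ~ algebraicOver (@ratr R) zeta.

(* A bound on a maximum over 1 <= j <= k is written as a bound for every j.
   "Arbitrarily large" forces x > 0 and X > 0 for all relevant solutions, so
   the values of powR at nonpositive bases play no role. *)
Definition lambda_exponent (R : realType) (k : nat) (zeta : R) : \bar R :=
  ereal_sup [set mu%:E | mu in [set mu : R |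
    forall N : int, exists x : int, N < x /\
      forall j : nat, (1 <= j <= k)%N ->
        dist_int (x%:~R * zeta ^+ j) <= x%:~R `^ (- mu)]].

(* 0 < min_j |x_j| is written as 0 < |x_j| for every j. *)
Definition chi_exponent (R : realType) (k : nat) (zeta : 'rV[R]_k) : \bar R :=
  ereal_sup [set nu%:E | nu in [set nu : R | 0 < nu /\
    forall B : R, exists2 X : R, B < X & exists x : 'rV[int]_k,
      forall j : 'I_k,
        [/\ 0 < `|x 0 j|,
            `|x 0 j|%:~R <= X &
            dist_int ((x 0 j)%:~R * zeta 0 j) <= X `^ (- nu)]]].

Definition power_row (R : realType) (k : nat) (zeta : R) : 'rV[R]_k :=
  \row_(j < k) zeta ^+ j.+1.

(* Main.v *)
(* Let [zeta] be the sum of the lacunary series [1 + \sum_n d_n / 2 ^ a_n] with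
   [d_n] in {1, 3} and [a_(n+1)] close to [k (lam + 1) a_n], and let [p / q] with
   [q = 2 ^ a_n] be its n-th partial sum.  The integers [x = q ^ k] give
   [lambda_k >= lam], and [chi_k >= lambda_k] by taking all [x_j] equal to [x].
   Conversely, a good approximation [x_j zeta ^ j] with [X ^ nu] larger than
   [q ^ j] (and [X] not too close to [q']), [q' = 2 ^ a_(n+1)] being the next
   denominator, forces [q ^ j %| x_j]; this is absurd if [X < q ^ j], and also
   if [j = k] and [nu > lam], since then [|zeta ^ k - (p / q) ^ k|] is too large.
   As [nu > 2], the intervals [(q ^ (j / nu), q ^ j)] for [j < k] together with
   [(q ^ (k / nu), q' / q ^ k)] overlap and reach [q' ^ (1 / nu)], so every large
   [X] is excluded by some coordinate [j].  Finally, [zeta] depends injectively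
   on the digits, so it is transcendental for some choice of them because the
   algebraic numbers are countable. *)
Require Import Defs.
From HB Require Import structures.
From mathcomp Require Import all_boot all_order all_algebra.
From mathcomp Require Import all_classical all_reals all_analysis.
From mathcomp Require Import zify ring lra.
Set Implicit Arguments.
Unset Strict Implicit.
Unset Printing Implicit Defensive.
Import Order.TTheory GRing.Theory Num.Theory.
Local Open Scope classical_set_scope.
Local Open Scope ring_scope.

(** * Distance to the nearest integer and differences of powers *)

Lemma dist_int_le (R : realType) (t : R) (n : int) : dist_int t <= `|t - n%:~R|.
Proof.
by apply: ge_inf; [exists 0 => _ [m _ <-]; exact: normr_ge0 | exists n].
Qed.

Lemma dist_int_lt (R : realType) (t e : R) :
  dist_int t < e -> exists n : int, `|t - n%:~R| < e.
Proof.
case/inf_lt=> [|_ [n _ <-] te]; last by exists n.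
by exists `|t - 0%:~R|; exists 0.
Qed.

Lemma subrX_ge (R : realDomainType) (x y : R) (j : nat) :
  1 <= x -> x <= y -> (0 < j)%N -> y - x <= y ^+ j - x ^+ j.
Proof.
move=> x1 xy; case: j => // j _.
have xj : 1 <= x ^+ j by exact: exprn_ege1.
have xyj : x ^+ j <= y ^+ j by rewrite lerXn2r ?nnegrE; lra.
rewrite !exprS; nra.
Qed.

Lemma subrX_le (R : realDomainType) (x y M : R) (j : nat) :
  0 <= x -> x <= y -> y <= M -> 1 <= M ->
  0 <= y ^+ j - x ^+ j <= j%:R * M ^+ j * (y - x).
Proof.
move=> x0 xy yM M1; elim: j => [|j /andP[IH0 IH]]; first by rewrite !expr0 subrr !mul0r lexx.
have xjM : x ^+ j <= M ^+ j by rewrite lerXn2r ?nnegrE; lra.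
have xj0 : 0 <= x ^+ j by exact: exprn_ge0.
have -> : y ^+ j.+1 - x ^+ j.+1 = y * (y ^+ j - x ^+ j) + x ^+ j * (y - x).
  by rewrite !exprS; ring.
apply/andP; split; first by rewrite addr_ge0 // mulr_ge0 //; lra.
have -> : j.+1%:R * M ^+ j.+1 * (y - x) =
    M * (j%:R * M ^+ j * (y - x)) + M * M ^+ j * (y - x).
  by rewrite -natr1 exprS; ring.
apply: lerD; first by apply: ler_pM => //; lra.
apply: ler_wpM2r; first lra.
apply: (le_trans xjM); rewrite ler_peMl //; exact: le_trans xjM.
Qed.

(** * Countability of the algebraic numbers *)

Lemma poly_roots_seq (F : fieldType) (p : {poly F}) :
  p != 0 -> exists s : seq F, forall x, root p x -> x \in s.
Proof.
have [n] := ubnP (size p); elim: n p => // n IHn p szp p0.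
have [[x px]|nroot] := pselect (exists x, root p x); last first.
  by exists [::] => x px; case: nroot; exists x.
have /factor_theorem[q pq] := px.
have q0 : q != 0 by apply: contraNneq p0 => q0; rewrite pq q0 mul0r.
have [|//|s qs] := IHn q.
  by move: szp; rewrite pq size_Mmonic ?monicXsubC // size_XsubC addn2.
exists (x :: s) => y; rewrite pq rootM root_XsubC inE => /orP[/qs ->|->] //.
by rewrite orbT.
Qed.

(** Cantor's diagonal: [S] differs at [n] from every sequence coded by [n], so [S] contradicts
    itself at its own code [f S]. *)
Lemma no_injection_to_nat (f : (nat -> bool) -> nat) : ~ injective f.
Proof.
move=> finj.
pose S n := `[< exists2 c, f c = n & c n = false >].
case: (boolP (S (f S))) => [|nS].
  by move=> SfS; move: (SfS) => /asboolP[c /finj -> ]; rewrite SfS.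
by move/asboolP: (nS); apply; exists S => //; exact: negbTE.
Qed.

(** An algebraic value [f c] is determined by a rational polynomial and an index in its list of
    roots. If all values were algebraic, pickling these pairs would inject the binary sequences into
    [nat]. *)
Lemma injective_transcendental (R : realType) (f : (nat -> bool) -> R) :
  injective f -> exists c, transcendental (f c).
Proof.
move=> finj; apply: contrapT => nex.
have alg c : algebraicOver (@ratr R) (f c).
  by apply: contrapT => nalg; apply: nex; exists c.
have /choice[S SP] : forall p : {poly rat}, exists s : seq R,
    p != 0 -> forall x, root (map_poly ratr p) x -> x \in s.
  move=> p; have [->|p0] := eqVneq p 0; first by exists [::].
  have [|s ps] := @poly_roots_seq R (map_poly ratr p); last by exists s.
  by rewrite map_poly_eq0.
have /choice[g gP] : forall c, exists pi : {poly rat} * nat,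
    nth 0 (S pi.1) pi.2 = f c.
  move=> c; have [p p0 pc] := alg c.
  by exists (p, index (f c) (S p)); rewrite nth_index // SP.
apply: (@no_injection_to_nat (pickle \o g)) => c d /(pcan_inj pickleK) gcd.
by apply: finj; rewrite -gP gcd gP.
Qed.

(** * Lacunary dyadic series *)

(** Gaps of at least 2 make [2 ^- a n] shrink by a factor 4 at each step, enough to keep the digits
    1 and 3 apart; [0 < a 0] makes the first numerator odd. *)
Definition lacunary (a : nat -> nat) :=
  (0 < a 0)%N /\ forall n, (a n + 2 <= a n.+1)%N.

(** Digits 1 and 3 instead of 0 and 1 keep every numerator odd, so that the fraction over [2 ^ a n]
    is reduced. *)
Fixpoint dyadic_num (a : nat -> nat) (c : nat -> bool) (n : nat) : nat :=
  if n is m.+1 then dyadic_num a c m * 2 ^ (a n - a m) + (2 * c n).+1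
  else 2 ^ a 0 + (2 * c 0).+1.

(* [1 + \sum_(i <= n) (1 + 2 c_i) / 2 ^ a_i] *)
Definition dyadic_sum (R : realType) (a : nat -> nat) (c : nat -> bool)
    (n : nat) : R :=
  (dyadic_num a c n)%:R / 2 ^+ a n.

Definition dyadic_series (R : realType) (a : nat -> nat) (c : nat -> bool) : R :=
  sup (range (dyadic_sum R a c)).

Lemma odd_dyadic_num (a : nat -> nat) (c : nat -> bool) (n : nat) :
  lacunary a -> odd (dyadic_num a c n).
Proof.
case=> a0 aS; case: n => [|n] /=; rewrite oddD ?oddM /= oddX /= oddM /=.
  by case: (a 0%N) a0.
by rewrite andbC; case: (a n.+1 - a n)%N (aS n) (subn_gt0 (a n) (a n.+1)) => //=; lia.
Qed.

Lemma dyadic_sum0 (R : realType) (a : nat -> nat) (c : nat -> bool) :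
  dyadic_sum R a c 0 = 1 + (2 * c 0)%N.+1%:R / 2 ^+ a 0.
Proof.
by rewrite /dyadic_sum /= natrD mulrDl natrX divff // expf_neq0.
Qed.

Lemma dyadic_sumS (R : realType) (a : nat -> nat) (c : nat -> bool) (n : nat) :
  lacunary a ->
  dyadic_sum R a c n.+1 =
  dyadic_sum R a c n + (2 * c n.+1)%N.+1%:R / 2 ^+ a n.+1.
Proof.
case=> _ aS; rewrite /dyadic_sum /= natrD mulrDl natrM natrX; congr (_ + _).
have -> : 2 ^+ a n.+1 = 2 ^+ (a n.+1 - a n) * 2 ^+ a n :> R.
  by rewrite -exprD subnK //; have := aS n; lia.
by rewrite invfM mulrA mulfK // expf_neq0.
Qed.

Lemma lacunary_lt (a : nat -> nat) (n : nat) : lacunary a -> (n < a n)%N.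
Proof. by case=> a0 aS; elim: n => // n IH; have := aS n; lia. Qed.

Lemma expr2V_lacunary (R : realType) (a : nat -> nat) (n : nat) :
  lacunary a -> 0 < (2 ^+ a n.+1 : R)^-1 <= (2 ^+ a n)^-1 / 4.
Proof.
case=> _ aS; apply/andP; split; first by rewrite invr_gt0 exprn_gt0.
rewrite -invfM lef_pV2 ?posrE ?mulr_gt0 ?exprn_gt0 //.
have -> : 2 ^+ a n * 4 = 2 ^+ (a n + 2) :> R by rewrite exprD; lra.
by rewrite ler_eXn2l // ltr1n.
Qed.

Lemma dyadic_digit_bounds (R : realType) (b : bool) :
  1 <= ((2 * b)%N.+1%:R : R) <= 3.
Proof. by rewrite ler1n ler_nat; case: b. Qed.

Lemma dyadic_sum_upper (R : realType) (a : nat -> nat) (c : nat -> bool)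
    (m n : nat) : lacunary a ->
  dyadic_sum R a c m <= dyadic_sum R a c n + 6 / 2 ^+ a n.+1.
Proof.
move=> la.
(* The upper bounds decrease with [i]: for [u = 2 ^- a i.+1], the new digit and the new error cost
   at most [3 u + 6 u / 4 <= 6 u]. *)
have up i : dyadic_sum R a c i.+1 + 6 / 2 ^+ a i.+2 <=
            dyadic_sum R a c i + 6 / 2 ^+ a i.+1.
  rewrite dyadic_sumS //.
  have /andP[] := expr2V_lacunary R i.+1 la.
  have /andP[] := dyadic_digit_bounds R (c i.+1).
  move: ((2 * c i.+1)%N.+1%:R : R) ((2 ^+ a i.+1)^-1) ((2 ^+ a i.+2)^-1) => d u v.
  move=> d1 d3 v0 vu.
  have : 0 <= (3 - d) * u by apply: mulr_ge0; lra.
  lra.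
have incr i : dyadic_sum R a c i <= dyadic_sum R a c i.+1.
  rewrite dyadic_sumS // lerDl divr_ge0 // exprn_ge0 //.
have pos i : 0 <= 6 / 2 ^+ a i.+1 :> R by rewrite divr_ge0 // exprn_ge0.
have [mn|/ltnW nm] := leqP m n.
  apply: le_trans (_ : dyadic_sum R a c n <= _); last by rewrite lerDl.
  exact: (homo_leq (@lexx _ _) (@le_trans _ _) incr).
apply: le_trans (_ : dyadic_sum R a c m + 6 / 2 ^+ a m.+1 <= _).
  by rewrite lerDl.
elim: m nm => [|m IH]; first by rewrite leqn0 => /eqP ->.
rewrite leq_eqVlt => /predU1P[<- //|]; rewrite ltnS => /IH; exact: le_trans.
Qed.

Lemma dyadic_series_bounds (R : realType) (a : nat -> nat) (c : nat -> bool)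
    (n : nat) : lacunary a ->
  (2 ^+ a n.+1)^-1 <= dyadic_series R a c - dyadic_sum R a c n
    <= 6 / 2 ^+ a n.+1.
Proof.
move=> la; apply/andP; split.
  rewrite lerBrDl; apply: le_trans (_ : dyadic_sum R a c n.+1 <= _).
    rewrite dyadic_sumS // lerD2l ler_peMl ?invr_ge0 ?exprn_ge0 //.
    by rewrite ler1n.
  apply: ub_le_sup; last by exists n.+1.
  by exists (dyadic_sum R a c 0 + 6 / 2 ^+ a 1) => _ [m _ <-]; exact: dyadic_sum_upper.
rewrite lerBlDl; apply: ge_sup; first by exists (dyadic_sum R a c 0), 0%N.
by move=> _ [m _ <-]; exact: dyadic_sum_upper.
Qed.

Lemma dyadic_sum_ge1 (R : realType) (a : nat -> nat) (c : nat -> bool)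
    (n : nat) : lacunary a -> 1 <= dyadic_sum R a c n.
Proof.
move=> la; elim: n => [|n IH].
  by rewrite dyadic_sum0 lerDl divr_ge0 // exprn_ge0.
rewrite dyadic_sumS //; apply: (le_trans IH).
by rewrite lerDl divr_ge0 // exprn_ge0.
Qed.

Lemma dyadic_series_le4 (R : realType) (a : nat -> nat) (c : nat -> bool) :
  lacunary a -> dyadic_series R a c <= 4.
Proof.
move=> la.
have /andP[_] := dyadic_series_bounds R c 0 la.
rewrite dyadic_sum0.
have /andP[] := expr2V_lacunary R 0 la.
have /andP[] := dyadic_digit_bounds R (c 0).
have : (2 ^+ a 0)^-1 <= 2^-1 :> R.
  rewrite lef_pV2 ?posrE ?exprn_gt0 //.
  by rewrite -[leLHS]expr1 ler_eXn2l ?ltr1n //; case: la.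
move: (dyadic_series R a c) ((2 * c 0)%N.+1%:R : R) ((2 ^+ a 0)^-1) ((2 ^+ a 1)^-1).
move=> z d u v u2 d1 d3 v0 vu zb.
have : 0 <= (3 - d) * u by apply: mulr_ge0; lra.
lra.
Qed.

(** At the first differing digit the partial sums are [2 u] apart, [u = 2 ^- a m]. The two tails lie
    in [[v, 6 v]] with [v <= u / 4], so they differ by at most [5 u / 4] and cannot compensate. *)
Lemma dyadic_series_inj (R : realType) (a : nat -> nat) :
  lacunary a -> injective (dyadic_series R a).
Proof.
move=> la c d cd; suff eqcd n : c n = d n /\ dyadic_sum R a c n = dyadic_sum R a d n.
  by apply/funext => n; case: (eqcd n).
have step x (b e : bool) m : dyadic_sum R a c m = x + (2 * b)%N.+1%:R / 2 ^+ a m ->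
    dyadic_sum R a d m = x + (2 * e)%N.+1%:R / 2 ^+ a m -> b = e.
  move=> cn dn.
  have /andP[] := dyadic_series_bounds R c m la.
  have /andP[] := dyadic_series_bounds R d m la.
  have /andP[] := expr2V_lacunary R m la.
  rewrite cd cn dn.
  case: b e {cn dn} => [] [] //=; rewrite ?muln0 ?muln1;
    move: (dyadic_series R a d) ((2 ^+ a m)^-1) ((2 ^+ a m.+1)^-1) => z u v; lra.
elim: n => [|n [_ IH]].
  have E := step _ _ _ _ (dyadic_sum0 R a c) (dyadic_sum0 R a d).
  by rewrite !dyadic_sum0 E.
have E : c n.+1 = d n.+1.
  by apply: (step (dyadic_sum R a d n) _ _ n.+1); rewrite dyadic_sumS // IH.
by rewrite !dyadic_sumS // E IH.
Qed.

(** * Divisibility forced by good approximations, and the covering of all large X *)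

(** Put [r = (p / 2 ^ a) ^ j] and [Q = 2 ^ (j a)], and let [m] be an integer close to [b z ^ j]. The
    integer [(b r - m) Q = b p ^ j - m Q] is below [1/2 + 1/2] in absolute value by the last two
    hypotheses, so it vanishes. As [p] is odd, [Q] divides [b]; moreover
    [b (z ^ j - r) = b z ^ j - m]. *)
Lemma dyadic_approximation (R : realType) (z e K X : R) (b : int) (p a j : nat) :
  odd p -> `|z ^+ j - (p%:R / 2 ^+ a) ^+ j| <= K ->
  `|b|%:~R <= X -> 0 < e -> dist_int (b%:~R * z ^+ j) <= e ->
  4 * e * 2 ^+ (j * a) <= 1 -> 2 * K * X * 2 ^+ (j * a) < 1 ->
  ((2 ^ (j * a))%N%:Z %| b)%Z /\
  `|b|%:~R * `|z ^+ j - (p%:R / 2 ^+ a) ^+ j| <= 2 * e.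
Proof.
move=> podd zK bX e0 de eQ KXQ.
(* [dist_int] is an infimum, so an integer is extracted from a strict bound; [2 * e] provides
   one. *)
have [m zm] : exists m : int, `|b%:~R * z ^+ j - m%:~R| < 2 * e.
  by apply: dist_int_lt; lra.
set Q : R := 2 ^+ (j * a) in eQ KXQ.
set r : R := (p%:R / 2 ^+ a) ^+ j in zK *.
have Q0 : 0 < Q by exact: exprn_gt0.
have rQ : r * Q = p%:R ^+ j.
  by rewrite /r /Q expr_div_n -exprM mulnC divfK // expf_neq0.
have b0 : 0 <= `|b|%:~R :> R by rewrite ler0z.
have bK : `|b%:~R * (z ^+ j - r)| <= K * X.
  by rewrite normrM -intr_norm mulrC ler_pM.
have eqQ : (b * (p ^ j)%N%:Z - m * (2 ^ (j * a))%N%:Z)%:~R =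
    (b%:~R * r - m%:~R) * Q :> R.
  rewrite intrB !intrM -!pmulrn !natrX mulrBl -mulrA rQ //.
have lt1 : `|(b * (p ^ j)%N%:Z - m * (2 ^ (j * a))%N%:Z)%:~R : R| < 1.
  rewrite eqQ normrM (gtr0_norm Q0).
  have : `|b%:~R * r - m%:~R| < K * X + 2 * e.
    have -> : b%:~R * r - m%:~R = (b%:~R * z ^+ j - m%:~R) - b%:~R * (z ^+ j - r).
      by ring.
    apply: le_lt_trans (ler_normB _ _) _; lra.
  move: (`|_|) => w wlt.
  have : (K * X + 2 * e - w) * Q > 0 by apply: mulr_gt0; lra.
  lra.
have eq0 : b * (p ^ j)%N%:Z - m * (2 ^ (j * a))%N%:Z = 0.
  by move: lt1; rewrite -intr_norm ltrz1 => ?; lia.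
split.
  rewrite -(@Gauss_dvdzl _ _ (p ^ j)%N%:Z).
    by apply/dvdzP; exists m; move/eqP: eq0; rewrite subr_eq0 => /eqP.
  rewrite /coprimez /gcdz !absz_nat eqz_nat -/(coprime _ _).
  by rewrite coprimeXl // coprimeXr // coprime2n.
rewrite intr_norm -normrM mulrBr.
suff -> : b%:~R * r = m%:~R by exact: ltW.
move: eqQ; rewrite eq0 => /esym/eqP; rewrite mulf_eq0 (gt_eqF Q0) orbF subr_eq0.
by move/eqP.
Qed.

(* [L] and [A n] stand for the logarithms of [X] and [2 ^ a_n]. *)
Lemma growth_covering (R : realType) (A : nat -> R) (k : nat) (nu D B : R) :
  (0 < k)%N -> 0 <= D -> 2 < nu -> (forall n, 0 <= A n) ->
  (forall n, 3 * k%:R * A n <= A n.+1) -> (forall M, exists n, M < A n) ->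
  exists L0, forall L, L0 < L -> exists n j : nat,
    [/\ B < A n, (0 < j <= k)%N, j%:R * A n + D < nu * L,
        L < A n.+1 - k%:R * A n - D & (j < k)%N -> L < j%:R * A n].
Proof.
move=> k0 D0 nu2 A0 AS Ainf.
have k1 : 1 <= k%:R :> R by rewrite ler1n.
have Amono m n : (m <= n)%N -> A m <= A n.
  apply: (homo_leq (@lexx _ _) (@le_trans _ _)) => i.
  apply: le_trans (AS i).
  have : 0 <= (k%:R - 1) * A i by apply: mulr_ge0 => //; lra.
  have := A0 i; lra.
(* Beyond [W], [D < (nu - 2) A n] will make consecutive intervals in [j] overlap, and [3 D < A n]
   will leave room before the next denominator. *)
pose W := Num.max B (Num.max (D / (nu - 2)) (3 * D)).
have [N NW] := Ainf W.
have large n : (N <= n)%N -> [/\ B < A n, D < (nu - 2) * A n & 3 * D < A n].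
  move=> /Amono Nn; have := lt_le_trans NW Nn.
  rewrite !gt_max => /and3P[-> + ->]; split => //.
  by rewrite mulrC -ltr_pdivrMr // subr_gt0.
exists ((A N + D) / nu) => L; rewrite ltr_pdivrMr 1?mulrC; last lra.
move=> NL.
(* Take the largest admissible [n], then the largest admissible [j]; maximality turns the failed
   inequalities at [n.+1] and [j.+1] into upper bounds on [nu * L]. *)
pose P n := (N <= n)%N && (A n + D < nu * L).
have [M ML] := Ainf (nu * L).
have [|n|n /andP[Nn nL] nmax] := @ex_maxnP P M; first by exists N; rewrite /P leqnn.
  case/andP=> _ nL; rewrite leqNgt; apply/negP => /ltnW/Amono; lra.
have [Bn Dn1 Dn2] := large n Nn.
have nL' : nu * L <= A n.+1 + D.
  rewrite leNgt; apply/negP => nL'; have := nmax n.+1.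
  by rewrite /P nL' ltnn (leqW Nn) => /(_ isT).
have An := A0 n.
have L0 : 0 < L by rewrite -(pmulr_rgt0 (x := nu)); lra.
have L2 : 0 < (nu - 2) * L by apply: mulr_gt0; lra.
pose Q j := (0 < j <= k)%N && (j%:R * A n + D < nu * L).
have [|j /andP[/andP[]]//|j /andP[jk jL] jmax] := @ex_maxnP Q k.
  by exists 1%N; rewrite /Q k0 mul1r.
exists n, j; split=> //.
  (* Here [2 L < A n.+1 + D], while [A n.+1 >= 3 k A n] and [3 D < A n] give
     [A n.+1 + D < 2 (A n.+1 - k A n - D)]. *)
  have := AS n.
  have : 0 <= (k%:R - 1) * A n by apply: mulr_ge0 => //; lra.
  lra.
move=> ltjk.
have jL' : nu * L <= j.+1%:R * A n + D.
  rewrite leNgt; apply/negP => jL'; have := jmax j.+1.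
  by rewrite /Q jL' ltnn ltjk => /(_ isT).
have j1 : 1 <= j%:R :> R by rewrite ler1n; case/andP: jk.
rewrite -(ltr_pM2l (x := nu)); last lra.
apply: (le_lt_trans jL'); rewrite -natr1.
(* It remains that [(j + 1) A n + D < nu j A n]: the difference of the [A n] terms is at least
   [(nu - 2) A n] because [j >= 1]. *)
have : 0 <= (j%:R - 1) * ((nu - 1) * A n) by rewrite !mulr_ge0 //; lra.
lra.
Qed.

(** * Bounds on the two exponents for dyadic series *)

Definition lambda_rate (R : realType) (k : nat) (zeta mu : R) :=
  forall N : int, exists x : int, N < x /\
    forall j : nat, (1 <= j <= k)%N ->
      dist_int (x%:~R * zeta ^+ j) <= x%:~R `^ (- mu).

Definition chi_rate (R : realType) (k : nat) (zeta : 'rV[R]_k) (nu : R) :=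
  forall B : R, exists2 X : R, B < X & exists x : 'rV[int]_k,
    forall j : 'I_k,
      [/\ 0 < `|x 0 j|,
          `|x 0 j|%:~R <= X &
          dist_int ((x 0 j)%:~R * zeta 0 j) <= X `^ (- nu)].

Lemma lambda_rate_chi (R : realType) (k : nat) (zeta mu : R) :
  lambda_rate k zeta mu -> chi_rate (power_row k zeta) mu.
Proof.
(* The maximum with 0 forces [x > 0], hence nonzero coordinates. *)
move=> lmu B; have [x [Nx xP]] := lmu (Num.max 0 (Num.ceil B)).
move: Nx; rewrite gt_max => /andP[x0 Bx].
exists x%:~R; first by rewrite (le_lt_trans (ceil_ge B)) // ltr_int.
exists (const_mx x) => j; rewrite !mxE normr_gt0 (gt_eqF x0) (gtr0_norm x0) lexx.
by split=> //; apply: xP; rewrite /= ltn_ord.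
Qed.

Lemma expr2_expR (R : realType) (n : nat) : 2 ^+ n = expR (n%:R * ln 2) :> R.
Proof. by rewrite expRM_natl lnK // posrE. Qed.

Lemma dyadic_power_bounds (R : realType) (a : nat -> nat) (c : nat -> bool)
    (k n j : nat) : lacunary a -> (j <= k)%N ->
  0 <= dyadic_series R a c ^+ j - dyadic_sum R a c n ^+ j
    <= 6 * k%:R * 4 ^+ k / 2 ^+ a n.+1.
Proof.
move=> la jk; have /andP[zr zr'] := dyadic_series_bounds R c n la.
have r1 := dyadic_sum_ge1 R c n la; have z4 := dyadic_series_le4 R c la.
have /andP[v0 _] := expr2V_lacunary R n la.
have /(_ j) : forall j, 0 <= dyadic_series R a c ^+ j - dyadic_sum R a c n ^+ j <=
    j%:R * 4 ^+ j * (dyadic_series R a c - dyadic_sum R a c n).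
  by move=> i; apply: subrX_le; lra.
case/andP=> -> /le_trans; apply.
have -> : 6 * k%:R * 4 ^+ k / 2 ^+ a n.+1 = k%:R * 4 ^+ k * (6 / 2 ^+ a n.+1) :> R.
  by ring.
apply: ler_pM => //; first lra.
by apply: ler_pM; rewrite ?exprn_ge0 ?ler_nat // ler_weXn2l // ler1n.
Qed.

Lemma dyadic_lambda_rate (R : realType) (a : nat -> nat) (c : nat -> bool)
    (k : nat) (mu : R) : lacunary a -> (0 < k)%N ->
  (forall (D : R) (m : nat), exists2 n, (m <= n)%N &
     k%:R * (mu + 1) * (a n)%:R + D <= (a n.+1)%:R) ->
  lambda_rate k (dyadic_series R a c) mu.
Proof.
move=> la k0 agrow N.
pose C : R := 6 * k%:R * 4 ^+ k.
have C0 : 0 < C by rewrite /C !mulr_gt0 ?exprn_gt0 // ltr0n.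
have l2 : 0 < ln 2 :> R by rewrite ln_gt0 // ltr1n.
(* With [x = 2 ^ (k a n)], the error [x C / 2 ^ a n.+1] is at most [x ^ (- mu)] as soon as [a n.+1]
   exceeds [k (mu + 1) a n] by the binary logarithm of [C]. *)
have [n Nn an] := agrow (ln C / ln 2) `|N|%N.
have nk : (n < k * a n)%N.
  by apply: (leq_trans (lacunary_lt n la)); rewrite leq_pmull.
exists (2 ^ (k * a n))%N%:Z; split.
  have := ltn_expl (k * a n) (isT : (1 < 2)%N); lia.
move=> j /andP[_ jk].
pose p := dyadic_num a c n.
have -> : (2 ^ (k * a n))%N%:~R = 2 ^+ (k * a n) :> R by rewrite -pmulrn natrX.
(* The integer is [x] times the [j]-th power of the partial sum, whose denominator divides [x]. *)
apply: le_trans (dist_int_le _ (p ^ j * 2 ^ ((k - j) * a n))%N%:Z) _.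
have -> : (p ^ j * 2 ^ ((k - j) * a n))%N%:~R =
    2 ^+ (k * a n) * dyadic_sum R a c n ^+ j.
  rewrite -pmulrn natrM !natrX /dyadic_sum expr_div_n -/p -exprM.
  have -> : 2 ^+ (k * a n) = 2 ^+ ((k - j) * a n) * 2 ^+ (a n * j) :> R.
    by rewrite -exprD mulnBl mulnC; congr (_ ^+ _); nia.
  by rewrite -[RHS]mulrA [X in _ = _ * X]mulrCA divff ?expf_neq0 // mulr1 mulrC.
have /andP[zr0 zr] := dyadic_power_bounds R c n la jk.
rewrite -mulrBr normrM !ger0_norm ?exprn_ge0 //.
have Q0 : 0 <= 2 ^+ (k * a n) :> R by rewrite exprn_ge0.
apply: (le_trans (ler_wpM2l Q0 zr)).
rewrite -/C -{1}(lnK (x := C)) // !expr2_expR -expRN -!expRD -expRM ler_expR.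
move: an; rewrite -(ler_pM2r l2) mulrDl divfK ?gt_eqF // natrM.
lra.
Qed.

Lemma dyadic_chi_rate_le (R : realType) (a : nat -> nat) (c : nat -> bool)
    (k : nat) (l nu : R) : lacunary a -> (0 < k)%N -> 2 <= l ->
  (forall n, (3 * k * a n <= a n.+1)%N) ->
  (forall n, (a n.+1)%:R <= k%:R * (l + 1) * (a n)%:R + 1) ->
  chi_rate (power_row k (dyadic_series R a c)) nu -> nu <= l.
Proof.
move=> la k0 l2 a3 aup rate; rewrite leNgt; apply/negP => lnu.
pose C : R := 6 * k%:R * 4 ^+ k.
have k1 : 1 <= k%:R :> R by rewrite ler1n.
have C2 : 2 <= C.
  have : 1 <= 4 ^+ k :> R by rewrite exprn_ege1 // ler1n.
  rewrite /C; nra.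
have ln20 : 0 < ln 2 :> R by rewrite ln_gt0 // ltr1n.
pose A n : R := (a n)%:R * ln 2.
pose D : R := ln (2 * C).
have D2 : 2 * ln 2 <= D.
  have -> : 2 * ln 2 = ln (2 ^+ 2) :> R by rewrite lnXn // mulr_natl.
  by rewrite expr2 ler_ln ?posrE; lra.
(* [D = ln (2 C)] absorbs the constants 4 and [2 C] required by [dyadic_approximation]; the lower
   bound on [A n] is what the final inequality for [j = k] contradicts. *)
have [|||||L0 cover] := @growth_covering R A k nu D (2 * ln 2 / (nu - l)) k0.
- lra.
- lra.
- by move=> n; rewrite mulr_ge0 // ltW.
- by move=> n; rewrite /A mulrA ler_pM2r // -!natrM ler_nat.
- move=> M; exists (Num.bound (M / ln 2)).
  rewrite -ltr_pdivrMr //; apply: lt_trans (unstable.ltr_bound _) _.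
  by rewrite ltr_nat lacunary_lt.
have [X L0X [x xP]] := rate (expR L0).
have X0 : 0 < X by apply: lt_trans L0X; exact: expR_gt0.
have /cover[n [j [Bn jk jL LA Lj]]] : L0 < ln X.
  by rewrite -ltr_expR lnK // posrE.
have XL : expR (ln X) = X by rewrite lnK // posrE.
move: (ln X) XL jL LA Lj => L XL jL LA Lj.
have [j0 jk'] := andP jk.
(* Coordinate [j.-1] of [power_row] carries the power [j]. *)
have jord : (j.-1 < k)%N by rewrite prednK.
have [] := xP (Ordinal jord).
rewrite !mxE /= prednK // normr_gt0 -XL -expRM; set b := x _ _ => b0 bX db.
have /andP[zr0 zr] := dyadic_power_bounds R c n la jk'.
have jkA : j%:R * A n <= k%:R * A n.
  by apply: ler_wpM2r; rewrite ?ler_nat // /A mulr_ge0 // ltW.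
have Qe : 2 ^+ (j * a n) = expR (j%:R * A n) :> R.
  by rewrite expr2_expR natrM mulrA.
have ve : (2 ^+ a n.+1)^-1 = expR (- A n.+1) :> R by rewrite expr2_expR expRN.
have CE : 2 * C = expR D by rewrite lnK // posrE; lra.
have e4 : 4 = expR (2 * ln 2) :> R by rewrite expRM_natl lnK ?posrE // expr2; lra.
have [|||||||] := @dyadic_approximation R (dyadic_series R a c)
  (expR (L * - nu)) (C / 2 ^+ a n.+1) (expR L) b (dyadic_num a c n) (a n) j.
- exact: odd_dyadic_num.
- by rewrite ger0_norm.
- exact: bX.
- exact: expR_gt0.
- exact: db.
- by rewrite Qe e4 -!expRD -[leRHS]expR0 ler_expR; lra.
- rewrite mulrA ve CE Qe -!expRD -[ltRHS]expR0 ltr_expR; lra.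
rewrite -/(dyadic_sum R a c n) (ger0_norm zr0) => Qb bzr.
have bQ : expR (j%:R * A n) <= `|b|%:~R.
  rewrite -Qe -natrX pmulrn ler_int.
  by rewrite -abszE lez_nat dvdn_leq // absz_gt0.
have jLe : j%:R * A n <= L by rewrite -ler_expR (le_trans bQ).
(* A nonzero multiple [b] of [2 ^ (j a n)] with [|b| <= X] contradicts [L < j A n], so only [j = k]
   survives. *)
have [/Lj|kj] := ltnP j k; first lra.
have jkE : j = k by apply/eqP; rewrite eqn_leq jk'.
have /andP[zn _] := dyadic_series_bounds R c n la.
have r1 := dyadic_sum_ge1 R c n la.
have zrX : expR (- A n.+1) <= dyadic_series R a c ^+ j - dyadic_sum R a c n ^+ j.
  rewrite -ve; apply: (le_trans zn); apply: subrX_ge => //.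
  have /andP[v0 _] := expr2V_lacunary R n la; lra.
have : expR (j%:R * A n) * expR (- A n.+1) <= expR (ln 2) * expR (L * - nu).
  rewrite lnK ?posrE //; apply: le_trans bzr.
  by apply: ler_pM => //; exact: expR_ge0.
rewrite -!expRD ler_expR jkE => fin.
(* One [ln 2] is the rounding in [a n.+1], the other the factor 2 in [fin]. With [k A n <= L] they
   give [k A n (nu - l) <= 2 ln 2], against [Bn]. *)
have : A n.+1 <= k%:R * (l + 1) * A n + ln 2.
  by rewrite /A; have := aup n; rewrite -(ler_pM2r ln20); lra.
move: Bn; rewrite ltr_pdivrMr ?subr_gt0 // => Bn.
rewrite jkE in jLe.
have : nu * (k%:R * A n) <= nu * L by rewrite ler_pM2l //; lra.
have : 0 <= (k%:R - 1) * (A n * (nu - l)).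
  by rewrite !mulr_ge0 ?subr_ge0 //; [exact: ltW|exact: ltW].
lra.
Qed.

(** * Exponent sequences of prescribed growth *)

(** The target exponent [t n] may vary with [n]: a constant [t] serves finite [lam], an unbounded
    one serves [+oo]. *)
Fixpoint growth_seq (R : realType) (k : nat) (t : nat -> R) (n : nat) : nat :=
  if n is m.+1 then `|Num.ceil (k%:R * (t m + 1) * (growth_seq k t m)%:R)|%N
  else 1.

Lemma growth_seqS (R : realType) (k : nat) (t : nat -> R) (n : nat) :
  (forall n, 2 <= t n) ->
  k%:R * (t n + 1) * (growth_seq k t n)%:R <= (growth_seq k t n.+1)%:R
    <= k%:R * (t n + 1) * (growth_seq k t n)%:R + 1.
Proof.
move=> t2 /=; set y := _ * _.
have y0 : 0 <= y by rewrite /y !mulr_ge0 //; have := t2 n; lra.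
have yc : 0 <= Num.ceil y by rewrite ceil_ge0; lra.
have -> : `|Num.ceil y|%N%:R = (Num.ceil y)%:~R :> R.
  by rewrite pmulrn gez0_abs.
have /andP[] := ceil_itv y; rewrite intrB => y1 ->; lra.
Qed.

Lemma growth_seq_mul3 (R : realType) (k : nat) (t : nat -> R) (n : nat) :
  (forall n, 2 <= t n) -> (3 * k * growth_seq k t n <= growth_seq k t n.+1)%N.
Proof.
move=> t2; rewrite -(ler_nat R).
have /andP[yle _] := growth_seqS k n t2; apply: le_trans yle.
rewrite !natrM; apply: ler_wpM2r => //.
have := t2 n; have : 0 <= k%:R :> R by [].
nra.
Qed.

Lemma growth_seq_lacunary (R : realType) (k : nat) (t : nat -> R) :
  (0 < k)%N -> (forall n, 2 <= t n) -> lacunary (growth_seq k t).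
Proof.
move=> k0 t2; split=> // n.
have pos m : (0 < growth_seq k t m)%N.
  elim: m => // m IH; apply: leq_trans (growth_seq_mul3 k m t2).
  by rewrite !muln_gt0 k0.
apply: leq_trans (growth_seq_mul3 k n t2).
have : (growth_seq k t n <= k * growth_seq k t n)%N by rewrite leq_pmull.
by have := pos n; rewrite -mulnA; lia.
Qed.

(** The surplus [d] in the exponent contributes at least [k d a_n], which eventually exceeds any
    constant [D]. *)
Lemma growth_seq_rate (R : realType) (k : nat) (t : nat -> R) (mu d D : R)
    (m : nat) : (0 < k)%N -> (forall n, 2 <= t n) -> 0 < d ->
  (exists n0, forall n, (n0 <= n)%N -> mu + d <= t n) ->
  exists2 n, (m <= n)%N &
    k%:R * (mu + 1) * (growth_seq k t n)%:R + D <= (growth_seq k t n.+1)%:R.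
Proof.
move=> k0 t2 d0 [n0 tn0]; pose n := maxn m (maxn n0 (Num.bound (D / d))).
exists n; first by rewrite leq_maxl.
have /andP[yle _] := growth_seqS k n t2; apply: le_trans yle.
have tn : mu + d <= t n by apply: tn0; rewrite !leq_max leqnn orbT.
have Dn : D < d * (growth_seq k t n)%:R.
  rewrite mulrC -ltr_pdivrMr //; apply: lt_trans (unstable.ltr_bound _) _; rewrite ltr_nat.
  apply: leq_ltn_trans (lacunary_lt n (growth_seq_lacunary k0 t2)).
  by rewrite !leq_max leqnn !orbT.
have k1 : 1 <= k%:R :> R by rewrite ler1n.
move: (growth_seq k t n)%:R (ler0n R (growth_seq k t n)) Dn => g g0 Dn.
have : 0 <= (k%:R - 1) * (d * g) by rewrite !mulr_ge0 ?subr_ge0 // ltW.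
have : 0 <= k%:R * ((t n - mu - d) * g) by rewrite !mulr_ge0 //; lra.
lra.
Qed.

Lemma growth_exponents (R : realType) (lam : \bar R) :
  (2%:E <= lam)%E ->
  exists t : nat -> R, [/\ forall n, 2 <= t n,
    forall l, lam = l%:E -> forall n, t n = l &
    forall mu, (mu%:E < lam)%E -> exists2 d, 0 < d &
      exists n0, forall n, (n0 <= n)%N -> mu + d <= t n].
Proof.
case: lam => [l| |//].
  rewrite lee_fin => l2; exists (fun=> l); split=> // [l' [->] //|mu].
  by rewrite lte_fin => ml; exists (l - mu); [lra | exists 0%N => n _; lra].
move=> _; exists (fun n => n%:R + 2); split=> // [n|mu _].
  by rewrite lerDr.
exists 1; first by [].
exists (Num.bound mu) => n; rewrite -(ler_nat R); have := unstable.ltr_bound mu; lra.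
Qed.

(** * Passage to the suprema and conclusion *)

Lemma ereal_sup_rate_ge (R : realType) (P : set R) (lam : \bar R) :
  (2%:E <= lam)%E -> (forall mu, 0 < mu -> (mu%:E < lam)%E -> P mu) ->
  (lam <= ereal_sup [set mu%:E | mu in P])%E.
Proof.
move=> lam2 lamP; rewrite leNgt; apply/negP.
have lb mu : 0 < mu -> (mu%:E < lam)%E -> (mu%:E <= ereal_sup [set mu%:E | mu in P])%E.
  by move=> mu0 mul; apply: ereal_sup_ubound; exists mu => //; exact: lamP.
(* This excludes [-oo] and makes a finite supremum [s] positive, so that the test values
   [(s + l) / 2] and [s + 1] are positive, as [chi_exponent] demands. *)
have : (1%:E <= ereal_sup [set mu%:E | mu in P])%E.
  by apply: lb => //; apply: lt_le_trans lam2; rewrite lte_fin ltr1n.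
move: (ereal_sup _) lb => [s| |//] lb; last by move=> _; rewrite ltNge leey.
rewrite lee_fin => s1; case: lam lb {lam2 lamP} => [l| |//] lb.
  rewrite lte_fin => sl; have s0 : 0 < (s + l) / 2 by lra.
  by have := lb _ s0; rewrite lte_fin lee_fin; lra.
have s0 : 0 < s + 1 by lra.
by move=> _; have := lb _ s0; rewrite ltry lee_fin; lra.
Qed.

Theorem theorem3p5 (R : realType) (k : nat) (hk : (1 <= k)%N) :
  (forall lam : \bar R, (2%:E <= lam)%E ->
    exists zeta : R,
      [/\ transcendental zeta,
          chi_exponent (power_row k zeta) = lambda_exponent k zeta &
          lambda_exponent k zeta = lam]) /\
  [set lam : \bar R | (2%:E <= lam)%E] `<=`
    [set chi_exponent (power_row k zeta) | zeta in [set z : R | transcendental z]].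
Proof.
suff main : forall lam : \bar R, (2%:E <= lam)%E ->
    exists zeta : R,
      [/\ transcendental zeta,
          chi_exponent (power_row k zeta) = lambda_exponent k zeta &
          lambda_exponent k zeta = lam].
  split=> // lam /main[zeta [tz chil laml]].
  by exists zeta => //; rewrite chil.
move=> lam lam2; have [t [t2 tl tmu]] := growth_exponents lam2.
pose a := growth_seq k t.
have la : lacunary a by exact: growth_seq_lacunary.
(* The bounds on the exponents hold for every digit sequence, so [c] is free to be chosen for
   transcendence alone. *)
have [c tc] := injective_transcendental (@dyadic_series_inj R a la).
exists (dyadic_series R a c); set z := dyadic_series R a c in tc *.
have lower mu : (mu%:E < lam)%E -> lambda_rate k z mu.
  move=> /tmu[d d0 td]; apply: dyadic_lambda_rate => // D m.
  exact: growth_seq_rate td.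
have upper nu : chi_rate (power_row k z) nu -> (nu%:E <= lam)%E.
  case: lam lam2 tl {tmu lower} => [l| |//]; last by move=> *; rewrite leey.
  rewrite !lee_fin => l2 /(_ _ erefl) tl; apply: dyadic_chi_rate_le => //.
    by move=> n; exact: growth_seq_mul3.
  by move=> n; have /andP[_] := growth_seqS k n t2; rewrite tl.
have lambdaE : lambda_exponent k z = lam.
  apply/eqP; rewrite eq_le; apply/andP; split.
    (* The upper bound for [chi_rate] also bounds [lambda_exponent], through [lambda_rate_chi]. *)
    by apply: ge_ereal_sup => _ [mu /lambda_rate_chi /upper ? <-].
  by apply: ereal_sup_rate_ge => // mu _ /lower.
split=> //; rewrite lambdaE; apply/eqP; rewrite eq_le; apply/andP; split.
  by apply: ge_ereal_sup => _ [nu [_ /upper ?] <-].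
by apply: ereal_sup_rate_ge => // mu mu0 /lower/lambda_rate_chi.
Qed.
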